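(* Assume the Generalized Riemann Hypothesis (GRH). Let $k$ be a positive integer such that $4\mid k$, $30<k<724$, and $2k-1$ is an odd prime power. Then the equation $$x^2+(2k-1)^y=k^z$$ in positive integers $x,y,z$ has only one solution, namely $(x,y,z)=(k-1,1,2)$.
   Context: ''$2k-1$ is an odd prime power'' means $2k-1=p^r$ with $p$ an odd prime and $r$ a positive integer. The result is conditional on the Generalized Riemann Hypothesis, taken here in its usual form for number-field computations: for every number field $K$, all zeros of the Dedekind zeta function $\zeta_K(s)$ with $0<\operatorname{Re}(s)<1$ satisfy $\operatorname{Re}(s)=1/2$. *)

(* Defs.v *)
From HB Require Import structures.
From mathcomp Require Import all_boot all_order all_algebra.
From mathcomp Require Import fieldext finmap.
From mathcomp Require Import all_classical all_reals all_analysis.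
From mathcomp.analysis Require Import showcase.summability.
From mathcomp.real_closed Require Import complex.

Set Implicit Arguments.
Unset Strict Implicit.
Unset Printing Implicit Defensive.

Import Order.TTheory GRing.Theory Num.Theory.
Import numFieldNormedType.Exports.

Local Open Scope classical_set_scope.
Local Open Scope ring_scope.

(* A number field is a [K : fieldExtType rat]: a field of finite dimension
   over the rationals. *)

Definition ring_of_integers (K : fieldExtType rat) : set K :=
  [set x | integralOver (intr : int -> K) x].
Arguments ring_of_integers : clear implicits.

Definition nonzero_ideal (K : fieldExtType rat) (I : set K) : Prop :=
  [/\ I `<=` ring_of_integers K,
      (exists2 x, I x & x != 0),
      (forall x y, I x -> I y -> I (x + y)) &
      (forall a x, ring_of_integers K a -> I x -> I (a * x))].

Definition cosets (K : fieldExtType rat) (I : set K) : set (set K) :=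
  [set [set x + a | a in I] | x in ring_of_integers K].

(* [fset_set] is empty on infinite sets, but the quotient of the ring of
   integers by a nonzero ideal is always finite. *)
Definition ideal_norm (K : fieldExtType rat) (I : set K) : nat :=
  #|` fset_set (cosets I)|.

Definition cexp (R : realType) (z : R[i]) : R[i] :=
  real_complex R (expR (complex.Re z))
  * Complex (cos (complex.Im z)) (sin (complex.Im z)).

(* The complex power [n ^ s] of an integer [n > 0]. *)
Definition cpow (R : realType) (n : nat) (s : R[i]) : R[i] :=
  cexp (s * real_complex R (ln n%:R)).

Definition dedekind_term (R : realType) (K : fieldExtType rat) (s : R[i])
    (I : set K) : R[i] :=
  if `[< nonzero_ideal I >] then cpow (ideal_norm I) (- s) else 0.

(* [Z] is the analytic continuation of the Dedekind zeta function of [K]: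
   it is holomorphic away from 1 (differentiability is over the field
   [R[i]], hence complex) and for [Re s > 1] it is the unordered sum, over all
   nonzero ideals, of [N(I) ^ (- s)].  By the identity theorem these conditions
   determine [Z] on the complement of 1. *)
Definition is_dedekind_zeta (R : realType) (K : fieldExtType rat)
    (Z : R[i] -> R[i]) : Prop :=
  (forall s : R[i], s != 1 ->
     derivable (Z : R[i]^o -> R[i]^o) s 1) /\
  (forall s : R[i], 1 < complex.Re s ->
     (partial_sum (@dedekind_term R K s : set K -> R[i]^o) @ totally)
       --> (Z s : R[i]^o)).

Definition GRH (R : realType) : Prop :=
  forall (K : fieldExtType rat) (Z : R[i] -> R[i]),
    is_dedekind_zeta K Z ->
    forall s : R[i], 0 < complex.Re s < 1 -> Z s = 0 ->
      complex.Re s = 2%:R^-1.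

Definition odd_prime_power (n : nat) : Prop :=
  exists p r : nat, [/\ prime p, odd p, (0 < r)%N & n = (p ^ r)%N].

(* Main.v *)
From Stdlib Require Import NArith FMapPositive Morphisms.
Require Import Defs.
From mathcomp Require Import all_boot all_order all_algebra all_reals.
From mathcomp Require Import zify.

(** Write [q = 2k - 1], so that the equation is [x^2 + q^y = k^z].  Reduction
    modulo 4 forces [y] to be odd, and the two parities of [z] are then treated
    by unrelated arguments.

    For [z = 2m] the left-hand side of [(k^m - x)(k^m + x) = q^y] has factors
    whose sum [2k^m] is prime to [q].  As [q] is a prime power, the smaller
    factor is 1, whence [2k^m = q^y + 1].  For odd [y] the right-hand side is
    [q + 1 = 2k] times an odd number, while [k] is even: this leaves only
    [m = 1] and gives the known solution ([even_exponent_solution]).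

    For odd [z] there is no solution, and congruences alone show it
    ([no_odd_solution]).  Suppose that [y] and [z] are known modulo [A] and [B].
    A prime [l] such that the orders of [q] and [k] modulo [l] divide [A] and
    [B] determines [k^z - q^y] modulo [l] from the two classes, and the classes
    for which this is not a square are impossible.  About half of the classes
    should disappear for each such prime, whereas passing from [A] to [f A] only
    multiplies their number by [f].  When [A] and [B] are products of small
    primes, so many primes [l] become available that every class disappears
    sooner or later.  The known solution does not stop this, since its [z] is
    even.  For each of the 56 values of [k] a short list of refinements and
    primes, found by computer search, empties the list of classes, and
    evaluation of the boolean function [sieve] verifies it.

    The sieve has to be cheap, so the tests are put in a form in which the work
    depending on [l] is shared by all [k].  Let [g] be a primitive root modulo
    [l], and let [q = g^th] and [k = g^ka].  If [z] is odd, then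
    [- ka * z + c] is even for [c] the parity of [ka]; multiplying the equation
    by this power of [g] gives [u^2 + g^e = g^c] with
    [e = th * y - ka * z + c] ([eqmod_exponent]).  For each of the two values of
    [c] the exponents [e] allowed by this congruence are tabulated once, and a
    test amounts to the evaluation of a linear form modulo [l - 1] and one
    search in a table. *)

(** * The equation modulo l in terms of a primitive root *)

Section Congruences.

Local Open Scope N_scope.

Variable l : N.

Definition eqmod (a b : N) : Prop := a mod l = b mod l.

Local Infix "≡" := eqmod (at level 70, no associativity).

#[local] Instance eqmod_equivalence : Equivalence eqmod.
Proof. by split=> [a | a b | a b c]; rewrite /eqmod // => ->. Qed.

#[local] Instance eqmod_add : Proper (eqmod ==> eqmod ==> eqmod) N.add.
Proof.
by move=> a a' Ha b b' Hb; rewrite /eqmod N.Div0.add_mod Ha Hb -N.Div0.add_mod.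
Qed.

#[local] Instance eqmod_mul : Proper (eqmod ==> eqmod ==> eqmod) N.mul.
Proof.
by move=> a a' Ha b b' Hb; rewrite /eqmod N.Div0.mul_mod Ha Hb -N.Div0.mul_mod.
Qed.

#[local] Instance eqmod_pow : Proper (eqmod ==> eq ==> eqmod) N.pow.
Proof.
move=> a a' Ha e _ <-; elim/N.peano_ind: e => [|e IHe]; first by rewrite !N.pow_0_r.
by rewrite !N.pow_succ_r' IHe Ha.
Qed.

Lemma eqmod_pow_period g n e : g ^ n ≡ 1 -> g ^ (e mod n) ≡ g ^ e.
Proof.
move=> gn1; rewrite {2}(N.Div0.div_mod e n).
by rewrite N.pow_add_r N.pow_mul_r gn1 N.pow_1_l N.mul_1_l.
Qed.

(** Since [g ^ n ≡ 1], the power [g ^ ((n - ka) * z)] is the inverse of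
    [k ^ z].  Multiplying the equation by it and by [g ^ c] turns the right-hand
    side into [g ^ c]; when the total exponent is even, the first term remains a
    square. *)
Lemma eqmod_exponent {g n q k th ka c h x y z} :
    g ^ n ≡ 1 -> g ^ th ≡ q -> g ^ ka ≡ k -> ka <= n ->
    (n - ka) * z + c = 2 * h -> x ^ 2 + q ^ y = k ^ z ->
  (x * g ^ h) ^ 2 + g ^ (th * y + ((n - ka) * z + c)) ≡ g ^ c.
Proof.
move=> gn1 gq gk le_ka_n even_h xyz.
have cancel : k ^ z * g ^ ((n - ka) * z) ≡ 1.
  rewrite -gk -N.pow_mul_r -N.pow_add_r.
  have -> : ka * z + (n - ka) * z = n * z by nia.
  by rewrite N.pow_mul_r gn1 N.pow_1_l.
rewrite N.pow_mul_l -[(g ^ h) ^ 2]N.pow_mul_r [h * 2]N.mul_comm -even_h.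
rewrite [g ^ (th * y + _)]N.pow_add_r [g ^ (th * y)]N.pow_mul_r gq.
rewrite -N.mul_add_distr_r xyz N.pow_add_r N.mul_assoc cancel.
by rewrite N.mul_1_l.
Qed.

Lemma eqmod_subl a b c : l <> 0 -> a + b ≡ c -> a ≡ c + (l - b mod l).
Proof.
move=> l_neq0 abc; have lt_b := N.mod_lt b l l_neq0.
have bl : b + (l - b mod l) ≡ 0.
  have -> : b + (l - b mod l) = (b / l + 1) * l.
    by have := N.Div0.div_mod b l; nia.
  by rewrite /eqmod N.Div0.mod_mul N.Div0.mod_0_l.
by rewrite -abc -N.add_assoc bl N.add_0_r.
Qed.

End Congruences.

(** * Dictionaries indexed by binary numbers *)

Section Dictionaries.

Definition dict (T : Type) := PositiveMap.t T.

Definition dict_of {T : Type} (s : seq (N * T)) : dict T :=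
  foldr (fun av d => PositiveMap.add (N.succ_pos av.1) av.2 d)
    (PositiveMap.empty T) s.

Definition lookup {T : Type} (d : dict T) (a : N) : option T :=
  PositiveMap.find (N.succ_pos a) d.

Lemma lookup_cons {T : Type} {s : seq (N * T)} {a b v} :
  lookup (dict_of ((b, v) :: s)) a =
    if a == b then Some v else lookup (dict_of s) a.
Proof.
rewrite /lookup /=; case: eqP => [-> | neq]; first exact: PositiveMap.gss.
by apply: PositiveMap.gso => eq_key; apply: neq; lia.
Qed.

Lemma lookup_mem {T : eqType} {s : seq (N * T)} {a v} :
  lookup (dict_of s) a = Some v -> (a, v) \in s.
Proof.
elim: s => [|[b w] s IHs]; first by rewrite /lookup PositiveMap.gempty.
rewrite lookup_cons inE; case: eqP => [-> [->] | _ /IHs ->]; last by rewrite orbT.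
by rewrite eqxx.
Qed.

Lemma mem_lookup {T : eqType} {s : seq (N * T)} {a v} :
  (a, v) \in s -> lookup (dict_of s) a.
Proof.
elim: s => [|[b w] s IHs] //; rewrite lookup_cons inE.
by case/orP=> [/eqP[-> _] | /IHs]; rewrite ?eqxx //; case: eqP.
Qed.

End Dictionaries.

(** * Discrete logarithms and admissible exponents modulo l *)

Section Tables.

Local Open Scope N_scope.

Definition range (n : N) : seq N := traject N.succ 0 (N.to_nat n).

Lemma mem_range n i : i < n -> i \in range n.
Proof.
move=> lt_i; apply/trajectP; exists (N.to_nat i); first by apply/ltP; lia.
have iter_succ j : iter j N.succ 0 = N.of_nat j.
  by elim: j => // j IHj; rewrite iterS IHj -Nat2N.inj_succ.
by rewrite iter_succ Nnat.N2Nat.id.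
Qed.

(** The pairs [(e, g ^ e mod l)] for [e <= n]; the last one, at [e = n], serves
    to check that [n] is a period of the powers of [g]. *)
Definition powers (l g : N) (n : nat) : seq (N * N) :=
  traject (fun ep => (N.succ ep.1, (g * ep.2) mod l)) (0, 1 mod l) n.+1.

Lemma iter_powers l g i :
  iter i (fun ep => (N.succ ep.1, (g * ep.2) mod l)) (0, 1 mod l)
    = (N.of_nat i, g ^ N.of_nat i mod l).
Proof.
elim: i => [|i IHi] //; rewrite iterS IHi [fst _]/= [snd _]/=.
by rewrite N.Div0.mul_mod_idemp_r -N.pow_succ_r' -Nat2N.inj_succ.
Qed.

Lemma powersP l g n e p :
  reflect (e <= N.of_nat n /\ p = g ^ e mod l) ((e, p) \in powers l g n).
Proof.
apply: (iffP trajectP) => [[i /ltP lt_i_n] | [le_e_n ->]].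
  by rewrite iter_powers => -[-> ->]; split=> //; lia.
exists (N.to_nat e); first by apply/ltP; lia.
by rewrite iter_powers Nnat.N2Nat.id.
Qed.

Lemma last_powers l g n :
  last (0, 0) (powers l g n) = (N.of_nat n, g ^ N.of_nat n mod l).
Proof. by rewrite -iter_powers -last_traject. Qed.

Definition squares (l : N) : dict N :=
  dict_of [seq ((a * a) mod l, a) | a <- range l].

Lemma lookup_squares l a : l <> 0 -> lookup (squares l) (a ^ 2 mod l).
Proof.
move=> l_neq0; apply: (@mem_lookup _ _ _ (a mod l)).
have -> : a ^ 2 mod l = ((a mod l) * (a mod l)) mod l.
  by rewrite -N.Div0.mul_mod N.pow_2_r.
apply: (map_f (fun a => ((a * a) mod l, a))); apply: mem_range.
exact: N.mod_lt.
Qed.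

(** For [ps] a list of pairs [(e, g ^ e mod l)] this is the set of the exponents
    [e] such that [c - g ^ e] is a square modulo [l]. *)
Definition differences (l : N) (sq : dict N) (ps : seq (N * N)) (c : N) : dict N :=
  dict_of [seq ep <- ps | lookup sq ((c + (l - ep.2)) mod l) : bool].

(** [diff_even] and [diff_odd] hold the admissible exponents for [g ^ c] with
    [c = 0] and [c = 1]. *)
Record table := Table
  { period : N; logs : dict N; diff_even : dict N; diff_odd : dict N }.

(** The conditions under which the logarithms are sound are decided by
    evaluation: a pair [(l, g)] that fails them gets an empty dictionary, and
    [l] then eliminates no class. *)
Definition log_dict (l : N) (ps : seq (N * N)) : dict N :=
  if [&& 1 <? l, N.even (l - 1) & (last (0, 0) ps).2 =? 1 mod l]
  then dict_of [seq (ep.2, ep.1) | ep <- ps] else PositiveMap.empty N.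

Definition table_of (l g : N) : table :=
  let n := l - 1 in
  let ps := powers l g (N.to_nat n) in
  let sq := squares l in
  Table n (log_dict l ps) (differences l sq ps 1) (differences l sq ps g).

Definition diff (t : table) (odd : bool) : dict N :=
  if odd then diff_odd t else diff_even t.

Lemma lookup_logs {l g a e} :
    lookup (logs (table_of l g)) (a mod l) = Some e ->
  [/\ 1 < l, N.even (l - 1), g ^ (l - 1) mod l = 1 mod l, e <= l - 1
    & g ^ e mod l = a mod l].
Proof.
rewrite [logs _]/(log_dict l (powers l g (N.to_nat (l - 1)))) /log_dict.
rewrite last_powers Nnat.N2Nat.id [snd _]/=.
case: ifP => [|_]; last by rewrite /lookup PositiveMap.gempty.
case/and3P => /N.ltb_spec0 l_gt1 even_n /N.eqb_spec period_n /lookup_mem.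
case/mapP=> -[e' p] /powersP[+ ->]; rewrite Nnat.N2Nat.id => le_e' [-> ->].
by split.
Qed.

Lemma lookup_diff {l g} {odd : bool} {u e} :
    1 < l -> g ^ (l - 1) mod l = 1 mod l ->
    (u ^ 2 + g ^ e) mod l = g ^ N.b2n odd mod l ->
  lookup (diff (table_of l g) odd) (e mod (l - 1)).
Proof.
move=> l_gt1 period_n diff_u.
have lt_e : e mod (l - 1) < l - 1 by apply: N.mod_lt; lia.
have pow_e : (e mod (l - 1), g ^ e mod l) \in powers l g (N.to_nat (l - 1)).
  apply/powersP; split; first by lia.
  exact/esym/eqmod_pow_period.
have sq_u : lookup (squares l) ((g ^ N.b2n odd + (l - g ^ e mod l)) mod l).
  by rewrite -(@eqmod_subl l (u ^ 2)) //; [apply: lookup_squares; lia | lia].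
have diffE : diff (table_of l g) odd =
    differences l (squares l) (powers l g (N.to_nat (l - 1))) (g ^ N.b2n odd).
  by case: (odd); rewrite /diff /table_of ?N.pow_1_r.
by rewrite diffE; apply: (@mem_lookup _ _ _ (g ^ e mod l)); rewrite mem_filter sq_u.
Qed.

End Tables.

(** * The sieve on the classes of the exponents *)

Section Sieve.

Local Open Scope N_scope.

Variables (tables : dict table) (q k : N).

(** The exponent [period t - ka] stands for [- ka]. *)
Definition passes (t : table) (th ka : N) (yz : N * N) : bool :=
  lookup (diff t (N.odd ka))
    ((th * yz.1 + ((period t - ka) * yz.2 + N.b2n (N.odd ka))) mod period t).

(** The outcome of a test depends on the classes of [y] modulo [A] and of [z]
    modulo [B] only if the linear form that it evaluates does so; a test for
    which this fails would be unsound and leaves the list as it is. *)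
Definition strain (A B : N) (S : seq (N * N)) (l : N) : seq (N * N) :=
  if lookup tables l is Some t then
    if (lookup (logs t) (q mod l), lookup (logs t) (k mod l)) is (Some th, Some ka)
    then
      if ((th * A) mod period t =? 0) && (((period t - ka) * B) mod period t =? 0)
      then filter (passes t th ka) S else S
    else S
  else S.

Definition lift (A B f g : N) (S : seq (N * N)) : seq (N * N) :=
  [seq (yz.1 + A * ij.1, yz.2 + B * ij.2) | yz <- S,
    ij <- [seq (i, j) | i <- range f, j <- range g]].

(** A step [(f, g, ls)] refines the moduli [A] and [B] by the factors [f] and
    [g], then tests the refined classes modulo each [l] in [ls]. *)
Fixpoint sieve (A B : N) (S : seq (N * N)) (steps : seq (N * N * seq N)) : bool :=
  if steps is (f, g, ls) :: steps' then
    [&& 0 <? f, 0 <? g & sieve (A * f) (B * g)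
       (foldl (strain (A * f) (B * g)) (lift A B f g S) ls) steps']
  else nilp S.

Definition covers (A B : N) (S : seq (N * N)) (y z : N) : Prop :=
  exists yz i j, [/\ yz \in S, y = yz.1 + A * i & z = yz.2 + B * j].

Definition genuine : Prop :=
  forall l t, lookup tables l = Some t -> exists g, t = table_of l g.

Lemma covers_strain {A B S} l {x y z} :
    genuine -> x ^ 2 + q ^ y = k ^ z -> N.odd z ->
  covers A B S y z -> covers A B (strain A B S l) y z.
Proof.
move=> tables_of xyz odd_z [[y0 z0] [i [j [S_yz /= Ey Ez]]]].
exists (y0, z0), i, j; split=> //.
rewrite /strain; case tabE: (lookup _ l) => [t|] //.
have [g t_def] := tables_of _ _ tabE.
case logq: (lookup (logs t) (q mod l)) => [th|] //.
case logk: (lookup (logs t) (k mod l)) => [ka|] //.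
case: ifP => // /andP[/N.eqb_spec dvdA /N.eqb_spec dvdB].
rewrite mem_filter S_yz andbT; move: logq logk dvdA dvdB; rewrite t_def.
have -> : period (table_of l g) = l - 1 by [].
set n := l - 1.
move=> /lookup_logs[l_gt1 even_n period_n _ gq].
move=> /lookup_logs[_ _ _ le_ka gk] dvdA dvdB.
rewrite /passes; have -> : period (table_of l g) = n by [].
have [h even_h] : exists h, (n - ka) * z + N.b2n (N.odd ka) = 2 * h.
  apply/N.even_spec; rewrite N.even_add N.even_mul N.even_sub //.
  rewrite even_n -(N.negb_odd z) odd_z orbF.
  by rewrite -(N.negb_odd ka); case: (N.odd ka).
have := eqmod_exponent l period_n gq gk le_ka even_h xyz.
move/(lookup_diff l_gt1 period_n); rewrite -/n.
(* The linear form takes the same value at the representative [(y0, z0)]. *)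
suff -> : (th * y + ((n - ka) * z + N.b2n (N.odd ka))) mod n =
   (th * y0 + ((n - ka) * z0 + N.b2n (N.odd ka))) mod n by [].
have [u Eu] : exists u, th * A = u * n.
  by exists (th * A / n); have := N.Div0.div_mod (th * A) n; lia.
have [v Ev] : exists v, (n - ka) * B = v * n.
  by exists ((n - ka) * B / n); have := N.Div0.div_mod ((n - ka) * B) n; lia.
rewrite -[RHS](N.Div0.mod_add _ (u * i + v * j)); congr (_ mod _).
rewrite Ey Ez; nia.
Qed.

Lemma covers_lift {A B f g S y z} :
    0 < f -> 0 < g -> covers A B S y z ->
  covers (A * f) (B * g) (lift A B f g S) y z.
Proof.
move=> f_gt0 g_gt0 [yz [i [j [S_yz Ey Ez]]]].
exists (yz.1 + A * (i mod f), yz.2 + B * (j mod g)), (i / f), (j / g); split.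
- apply/allpairsP; exists (yz, (i mod f, j mod g)); split=> //=.
  apply/allpairsP; exists (i mod f, j mod g); split=> //=.
    by apply/mem_range/N.mod_lt; lia.
  by apply/mem_range/N.mod_lt; lia.
- by rewrite Ey [X in A * X](N.Div0.div_mod i f) /=; lia.
- by rewrite Ez [X in B * X](N.Div0.div_mod j g) /=; lia.
Qed.

Lemma sieve_sound {A B S} steps {x y z} :
    genuine -> x ^ 2 + q ^ y = k ^ z -> N.odd z -> covers A B S y z ->
  ~~ sieve A B S steps.
Proof.
move=> tables_of xyz odd_z.
elim: steps A B S => [|[[f g] ls] steps IHs] A B S coverS /=.
  by case: coverS => yz [_ [_ [S_yz _ _]]]; case: S S_yz.
apply/and3P => -[/N.ltb_spec0 f_gt0 /N.ltb_spec0 g_gt0]; apply/negP/IHs.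
move/(covers_lift f_gt0 g_gt0): coverS.
elim: ls (lift _ _ _ _ _) => //= l ls IHls T.
by move/(covers_strain l tables_of xyz odd_z)/IHls.
Qed.

End Sieve.

(** * The certificates *)

Section Certificates.

Local Open Scope N_scope.

Definition primitive_roots : seq (N * N) :=
  [:: (5, 2); (7, 3); (11, 2); (13, 2); (17, 3); (19, 2); (23, 5); (29, 2);
      (31, 3); (37, 2); (41, 6); (43, 3); (53, 2); (61, 2); (67, 2); (71,
      7); (73, 5); (79, 3); (89, 3); (97, 5); (101, 2); (109, 6); (113, 3);
      (127, 3); (131, 2); (151, 6); (157, 5); (163, 2); (181, 2); (193, 5);
      (199, 3); (211, 2); (241, 7); (251, 6); (271, 6); (281, 3); (313, 10);
      (331, 3); (337, 10); (379, 2); (397, 5); (401, 3); (421, 2); (433, 5);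
      (449, 3); (487, 3); (491, 2); (541, 2); (577, 5); (601, 7); (617, 3);
      (631, 3); (641, 3); (661, 2); (673, 5); (701, 2); (751, 3); (757, 2);
      (769, 11); (811, 3); (881, 3); (991, 6); (1009, 11); (1051, 7); (1171,
      2); (1201, 11); (1297, 10); (1321, 13); (1409, 3); (1601, 3); (1621,
      2); (1801, 11); (1873, 10)].

(** For each [k] such that [2 * k - 1] is a prime power, the steps of a sieve
    that starts from odd [y] and [z] and ends with no class left.  The order of
    the refinements was optimised to keep the lists of classes short: they
    rarely exceed a few hundred pairs, although most final moduli are in the
    thousands. *)
Definition certificates : seq (N * seq (N * N * seq N)) :=
  [:: (36, [:: (9, 1, [:: 37]); (1, 9, [:: 19; 73]); (2, 1, [:: 13]); (5, 1,
        [:: 31; 541]); (1, 5, [:: 11; 61; 181]); (2, 2, [:: 41; 1297]);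
        (2, 1, [:: 241; 577]); (2, 1, [:: 97]); (1, 2, [:: 17]); (1, 7,
        [:: 113; 211]); (7, 1, [:: 29; 43; 127; 281; 337; 421])]);
      (40, [:: (4, 1, [:: 41]); (5, 10, [:: 11; 241]); (3, 3, [:: 7; 31; 61]);
        (3, 1, [:: 181]); (1, 3, [:: 19; 37])]);
      (52, [:: (5, 5, [:: 11]); (3, 1, [:: 61]); (1, 3, [:: 7; 31]); (7, 7,
        [:: 29; 43; 71; 211]); (1, 2, [:: 421]); (2, 1, [:: 337]); (1, 2,
        [:: 41]); (2, 1, [:: 73; 281; 617]); (2, 1, [:: 113; 673]); (1, 3,
        [:: 19; 37]); (1, 2, [:: 241; 1009]); (1, 2, [:: 97; 641]); (3, 1,
        [:: 127; 181; 631]); (3, 1, [:: 379; 541]); (1, 3, [:: 109; 271;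
        433; 757]); (1, 5, [:: 1201]); (5, 1, [:: 101; 151; 401; 601; 701;
        1051]); (2, 2, [:: 1601]); (2, 1, [:: 193; 449]); (3, 3, [:: 163;
        811; 1297]); (1, 13, [:: 79; 1171]); (13, 1, [:: 53; 131; 157;
        313])]);
      (64, [:: (2, 1, [:: 5]); (3, 1, [:: 13]); (3, 3, [:: 19])]);
      (76, [:: (3, 1, [:: 7]); (5, 1, [:: 11]); (1, 15, [:: 31]); (2, 1,
        [:: 61]); (1, 2, [:: 13]); (1, 2, [:: 601]); (2, 1, [:: 17; 41]);
        (1, 2, [:: 241; 401]); (3, 1, [:: 73]); (1, 3, [:: 37]); (3, 1,
        [:: 109]); (1, 3, [:: 271; 541; 1621]); (2, 1, [:: 433; 577])]);
      (84, [:: (2, 1, [:: 5]); (9, 3, [:: 19; 37]); (5, 5, [:: 11; 31; 271]);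
        (1, 2, [:: 13; 61]); (2, 1, [:: 41]); (2, 1, [:: 17]); (1, 3,
        [:: 181]); (1, 2, [:: 73]); (1, 2, [:: 241; 433]); (1, 5, [:: 151;
        601; 1201]); (5, 1, [:: 101; 401; 1601; 1801]); (7, 1, [:: 379;
        701]); (1, 7, [:: 29; 43; 71; 113]); (2, 1, [:: 673]); (1, 2,
        [:: 97]); (1, 2, [:: 449]); (3, 1, [:: 757]); (1, 3, [:: 541]);
        (3, 3, [:: 163; 487; 811; 1621])]);
      (96, [:: (4, 4, [:: 41]); (3, 1, [:: 13]); (2, 1, [:: 97]); (1, 3, [:: 7;
        337]); (1, 5, [:: 31]); (5, 1, [:: 11; 61; 241]); (1, 3, [:: 37]);
        (3, 1, [:: 73; 181]); (1, 3, [:: 109; 271; 541]); (1, 2,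
        [:: 17])]);
      (100, [:: (3, 3, [:: 7; 13]); (2, 1, [:: 37]); (7, 7, [:: 29]); (3, 1,
        [:: 127]); (1, 3, [:: 19; 1009]); (1, 3, [:: 109; 379; 757]); (1,
        5, [:: 211; 631]); (5, 1, [:: 31; 61; 71; 181; 271; 421]); (2, 1,
        [:: 281]); (1, 2, [:: 73]); (1, 2, [:: 433])]);
      (112, [:: (7, 7, [:: 29]); (1, 3, [:: 43]); (2, 1, [:: 421]); (1, 5,
        [:: 211]); (3, 1, [:: 31]); (1, 2, [:: 13; 61]); (5, 1, [:: 11;
        71; 281]); (1, 2, [:: 41]); (1, 2, [:: 673]); (2, 1, [:: 17;
        241]); (2, 1, [:: 113; 337]); (1, 3, [:: 181]); (3, 1, [:: 19; 73;
        127; 631; 1009]); (3, 1, [:: 379; 1297])]);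
      (120, [:: (7, 7, [:: 29]); (1, 5, [:: 71]); (2, 1, [:: 701]); (2, 1,
        [:: 113]); (1, 3, [:: 13]); (5, 1, [:: 11; 211]); (3, 1, [:: 31;
        43]); (1, 2, [:: 61; 421]); (1, 2, [:: 41; 241; 281]); (3, 1,
        [:: 541]); (1, 3, [:: 19; 37; 127])]);
      (132, [:: (3, 1, [:: 7]); (3, 1, [:: 19]); (1, 6, [:: 13]); (1, 3, [:: 37;
        109]); (5, 1, [:: 181]); (1, 5, [:: 31; 61; 271]); (4, 1, [:: 17;
        41]); (1, 2, [:: 73]); (5, 1, [:: 151; 601]); (1, 5, [:: 101;
        1801]); (1, 2, [:: 401; 1201]); (2, 1, [:: 241]); (2, 1, [:: 97]);
        (1, 2, [:: 577; 1601]); (7, 1, [:: 701; 1051]); (1, 7, [:: 29; 43;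
        71; 113; 127])]);
      (136, [:: (5, 5, [:: 11]); (1, 3, [:: 31; 61]); (3, 1, [:: 7]); (3, 3,
        [:: 19; 37]); (2, 1, [:: 181]); (3, 1, [:: 109; 541]); (1, 2,
        [:: 13]); (1, 2, [:: 41]); (2, 1, [:: 73]); (1, 2, [:: 241]); (1,
        3, [:: 433]); (1, 3, [:: 1297; 1621]); (3, 1, [:: 163; 811]); (7,
        1, [:: 43; 757; 1009]); (1, 7, [:: 29; 71; 127; 211; 281])]);
      (156, [:: (3, 3, [:: 7]); (5, 5, [:: 11; 211]); (2, 1, [:: 61; 181]); (2,
        2, [:: 41]); (7, 1, [:: 71; 421]); (1, 2, [:: 337]); (3, 1,
        [:: 37; 73]); (1, 7, [:: 29; 43; 281]); (1, 3, [:: 19; 127; 631]);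
        (1, 3, [:: 109; 379; 757]); (1, 2, [:: 113]); (2, 1, [:: 17; 241;
        1009])]);
      (172, [:: (2, 3, [:: 13]); (5, 5, [:: 11; 31]); (2, 2, [:: 41; 61]); (1,
        4, [:: 193]); (2, 1, [:: 17; 241]); (1, 3, [:: 73; 181]); (3, 1,
        [:: 541]); (7, 1, [:: 337; 631]); (1, 7, [:: 29; 71; 113; 127;
        211; 281; 1009]); (3, 1, [:: 109; 433; 757])]);
      (180, [:: (5, 5, [:: 11; 41]); (6, 1, [:: 61]); (1, 3, [:: 7; 31]); (3, 1,
        [:: 181]); (1, 3, [:: 19; 109]); (1, 2, [:: 13; 37]); (1, 2,
        [:: 73; 241])]);
      (184, [:: (2, 1, [:: 5]); (3, 3, [:: 7]); (3, 1, [:: 37; 1621]); (1, 2,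
        [:: 13]); (1, 3, [:: 73]); (1, 5, [:: 31]); (5, 1, [:: 11; 181]);
        (3, 1, [:: 109; 271]); (1, 3, [:: 541]); (1, 4, [:: 433; 1201]);
        (4, 1, [:: 17; 241; 337]); (2, 2, [:: 577]); (7, 1, [:: 113;
        1009]); (1, 7, [:: 29; 43; 71; 127; 211])]);
      (192, [:: (6, 3, [:: 7; 13]); (3, 3, [:: 19; 37]); (1, 2, [:: 73]); (3, 3,
        [:: 109; 433]); (5, 1, [:: 31; 541]); (1, 5, [:: 11; 61; 181;
        271]); (4, 1, [:: 193; 1201]); (1, 2, [:: 41; 241; 281]); (3, 1,
        [:: 1621]); (1, 3, [:: 163; 1297]); (7, 1, [:: 211; 1009])]);
      (216, [:: (3, 1, [:: 7]); (2, 2, [:: 13]); (2, 1, [:: 97]); (1, 3,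
        [:: 73]); (3, 1, [:: 19; 37]); (5, 1, [:: 31; 541]); (1, 5,
        [:: 11; 61; 181]); (2, 1, [:: 241; 1201]); (1, 6, [:: 163])]);
      (220, [:: (3, 1, [:: 13]); (1, 3, [:: 7]); (3, 1, [:: 19])]);
      (232, [:: (2, 8, [:: 17]); (1, 3, [:: 13]); (1, 2, [:: 97]); (9, 1,
        [:: 37]); (1, 3, [:: 19; 73]); (1, 5, [:: 181]); (5, 1, [:: 31;
        61; 271; 881]); (2, 1, [:: 41]); (7, 1, [:: 127; 211; 281; 337]);
        (1, 7, [:: 43; 71; 113; 379; 421; 631; 757]); (2, 1, [:: 241;
        1009])]);
      (240, [:: (5, 5, [:: 11]); (3, 1, [:: 31; 181]); (1, 3, [:: 7]); (7, 1,
        [:: 421]); (1, 7, [:: 43; 71; 211; 491]); (3, 1, [:: 19; 631]);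
        (2, 2, [:: 29])]);
      (244, [:: (2, 1, [:: 5]); (3, 1, [:: 7]); (1, 3, [:: 13]); (1, 3,
        [:: 19]); (1, 2, [:: 37; 73]); (5, 5, [:: 11; 31; 41; 181]); (7,
        1, [:: 29]); (1, 7, [:: 43; 71; 211; 421]); (3, 1, [:: 127; 271;
        631])]);
      (252, [:: (3, 2, [:: 13]); (5, 1, [:: 11]); (1, 5, [:: 31; 61; 421]); (2,
        3, [:: 181]); (3, 1, [:: 271; 541]); (1, 3, [:: 19; 37]); (1, 7,
        [:: 631; 1009]); (7, 1, [:: 29; 43; 71; 127; 211; 281]); (1, 2,
        [:: 73]); (2, 1, [:: 41; 113]); (2, 1, [:: 337]); (1, 2,
        [:: 241]); (3, 1, [:: 109])]);
      (300, [:: (3, 1, [:: 7]); (3, 9, [:: 19; 37]); (2, 1, [:: 109]); (5, 1,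
        [:: 181; 271]); (1, 5, [:: 11; 31; 61]); (1, 7, [:: 631]); (7, 1,
        [:: 43; 71; 127; 211; 421]); (1, 2, [:: 29; 337]); (1, 2,
        [:: 1009]); (2, 1, [:: 281]); (2, 1, [:: 241])]);
      (304, [:: (5, 1, [:: 61])]);
      (316, [:: (6, 2, [:: 61]); (1, 3, [:: 13]); (3, 3, [:: 37; 541]); (2, 1,
        [:: 73]); (1, 2, [:: 433]); (1, 2, [:: 17]); (2, 1, [:: 97]); (1,
        5, [:: 181]); (5, 1, [:: 11; 31; 41; 241]); (1, 5, [:: 401;
        1201]); (5, 1, [:: 101; 151; 601; 1801]); (2, 1, [:: 1601]); (1,
        2, [:: 641]); (1, 2, [:: 577]); (2, 1, [:: 193]); (1, 7, [:: 449;
        673]); (7, 1, [:: 29; 43; 71; 113; 127; 211; 281; 337; 701;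
        1009])]);
      (324, [:: (3, 1, [:: 13]); (2, 1, [:: 5]); (1, 3, [:: 7]); (1, 5,
        [:: 41]); (5, 1, [:: 11; 31; 61]); (1, 7, [:: 211]); (7, 1,
        [:: 29; 43; 71; 281; 421]); (2, 1, [:: 337; 449]); (1, 2,
        [:: 113])]);
      (360, [:: (3, 3, [:: 7; 13]); (3, 1, [:: 19; 37]); (1, 5, [:: 31]); (1, 2,
        [:: 61]); (7, 1, [:: 29]); (5, 1, [:: 11; 71]); (1, 7, [:: 43;
        211]); (2, 1, [:: 241; 281; 421]); (1, 3, [:: 127; 181; 631]); (2,
        1, [:: 41; 1009]); (1, 3, [:: 379; 757]); (3, 1, [:: 109; 271]);
        (1, 4, [:: 113; 433]); (2, 1, [:: 17; 337]); (1, 5, [:: 401]); (5,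
        1, [:: 101; 151; 701; 1051])]);
      (364, [:: (2, 1, [:: 5]); (3, 1, [:: 73]); (7, 7, [:: 29; 211]); (1, 4,
        [:: 113]); (1, 2, [:: 17]); (4, 1, [:: 337; 673]); (1, 3, [:: 43;
        97]); (1, 5, [:: 241; 281; 421]); (5, 1, [:: 31; 41; 61; 71]); (3,
        1, [:: 37]); (1, 3, [:: 19; 127; 181; 271; 631])]);
      (372, [:: (5, 5, [:: 11]); (1, 2, [:: 101]); (2, 2, [:: 41]); (7, 1,
        [:: 71]); (1, 7, [:: 29; 281; 617]); (3, 1, [:: 13; 421]); (1, 3,
        [:: 43; 61; 211]); (3, 1, [:: 19; 631]); (2, 1, [:: 73; 97])]);
      (376, [:: (3, 1, [:: 13]); (1, 2, [:: 37]); (5, 5, [:: 11; 31]); (1, 3,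
        [:: 7; 61]); (1, 5, [:: 151]); (5, 1, [:: 251; 401; 601]); (2, 1,
        [:: 101]); (4, 1, [:: 241]); (1, 2, [:: 17; 41]); (1, 2, [:: 97;
        1201]); (1, 3, [:: 73; 181]); (3, 1, [:: 19; 1801]); (1, 3,
        [:: 433]); (3, 1, [:: 109; 271; 541; 811; 1621])]);
      (412, [:: (3, 1, [:: 7]); (1, 3, [:: 13]); (5, 5, [:: 11; 31; 211]); (2,
        1, [:: 61]); (2, 2, [:: 41]); (1, 2, [:: 97]); (1, 3, [:: 181;
        271]); (3, 1, [:: 19; 37; 73])]);
      (420, [:: (2, 9, [:: 109]); (3, 1, [:: 13]); (3, 1, [:: 19; 73]); (1, 2,
        [:: 37]); (5, 1, [:: 1171]); (1, 5, [:: 11; 31; 61; 181]); (7, 1,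
        [:: 421]); (1, 7, [:: 29; 43; 71; 127; 211; 631]); (2, 1,
        [:: 41]); (2, 1, [:: 113; 1009]); (1, 2, [:: 281]); (1, 2, [:: 17;
        241; 337])]);
      (432, [:: (2, 3, [:: 13]); (3, 1, [:: 7]); (1, 5, [:: 31]); (5, 1, [:: 11;
        61; 211]); (1, 3, [:: 19; 181]); (3, 1, [:: 37]); (3, 1, [:: 109;
        433]); (1, 3, [:: 271; 541]); (1, 7, [:: 421]); (7, 1, [:: 43; 71;
        127; 379])]);
      (444, [:: (2, 1, [:: 5]); (3, 6, [:: 7; 13]); (5, 5, [:: 11; 31; 61]); (3,
        1, [:: 19; 181]); (1, 7, [:: 29; 631]); (7, 1, [:: 43; 71; 127;
        211; 421]); (2, 1, [:: 449]); (2, 1, [:: 113]); (1, 2, [:: 17; 41;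
        337]); (1, 3, [:: 73; 1009])]);
      (456, [:: (7, 7, [:: 113]); (1, 3, [:: 43; 211])]);
      (460, [:: (5, 5, [:: 11]); (3, 1, [:: 751]); (1, 2, [:: 13; 61]); (1, 3,
        [:: 7; 31]); (1, 3, [:: 19]); (2, 1, [:: 37]); (2, 1, [:: 41]);
        (1, 2, [:: 73]); (3, 1, [:: 181]); (1, 3, [:: 271; 1621]); (3, 1,
        [:: 109; 433; 541]); (1, 3, [:: 163; 811]); (1, 2, [:: 241;
        1297]); (1, 7, [:: 113; 421]); (7, 1, [:: 29; 43; 71])]);
      (484, [:: (2, 1, [:: 5]); (1, 3, [:: 13]); (9, 2, [:: 73]); (1, 3, [:: 19;
        37]); (1, 5, [:: 31; 181]); (5, 1, [:: 61]); (2, 1, [:: 41]); (1,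
        2, [:: 17; 241]); (1, 3, [:: 271; 541]); (7, 1, [:: 127; 631]);
        (1, 7, [:: 29; 43; 113; 281])]);
      (492, [:: (3, 3, [:: 7]); (5, 5, [:: 11; 31]); (1, 7, [:: 43; 631]); (7,
        1, [:: 71; 127; 211; 281]); (2, 1, [:: 29; 61]); (1, 2, [:: 13;
        421]); (3, 1, [:: 37; 181]); (1, 3, [:: 19; 757]); (2, 1,
        [:: 73]); (2, 1, [:: 17; 241])]);
      (496, [:: (3, 1, [:: 7]); (7, 7, [:: 421]); (1, 2, [:: 29]); (1, 3,
        [:: 13; 43]); (5, 1, [:: 71]); (1, 5, [:: 61; 211; 331]); (2, 1,
        [:: 701]); (2, 1, [:: 41; 281]); (1, 3, [:: 37; 127; 181]); (3, 1,
        [:: 19; 631; 757]); (1, 2, [:: 73; 113]); (1, 2, [:: 241; 1009]);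
        (2, 1, [:: 17; 337]); (2, 1, [:: 97]); (1, 5, [:: 151; 1051]); (5,
        1, [:: 101; 601; 1201; 1601])]);
      (516, [:: (3, 3, [:: 7]); (5, 1, [:: 11]); (1, 5, [:: 31]); (3, 1,
        [:: 181]); (2, 2, [:: 61]); (1, 3, [:: 19; 37]); (1, 2, [:: 73]);
        (2, 1, [:: 41]); (1, 2, [:: 97; 241]); (2, 1, [:: 17]); (1, 3,
        [:: 163; 433]); (3, 1, [:: 109; 271; 541]); (1, 3, [:: 811;
        1621]); (5, 1, [:: 601]); (1, 5, [:: 101; 151; 401; 701; 1201;
        1801]); (1, 7, [:: 281]); (7, 1, [:: 29; 71; 113; 127; 337;
        379])]);
      (520, [:: (3, 3, [:: 7]); (4, 1, [:: 73]); (1, 8, [:: 17]); (5, 1, [:: 61;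
        241]); (1, 5, [:: 11; 31; 41; 401]); (3, 1, [:: 19; 1801]); (1, 3,
        [:: 37; 181]); (3, 1, [:: 1621]); (1, 3, [:: 109; 163; 271; 541]);
        (2, 1, [:: 433]); (2, 1, [:: 97]); (2, 1, [:: 193]); (3, 1,
        [:: 811; 1297]); (1, 7, [:: 43; 421]); (7, 1, [:: 29; 71; 113;
        127; 211; 379])]);
      (532, [:: (3, 1, [:: 13]); (4, 1, [:: 41]); (1, 4, [:: 97]); (1, 2,
        [:: 17]); (1, 3, [:: 37]); (5, 1, [:: 31]); (1, 5, [:: 11; 61]);
        (2, 1, [:: 241]); (1, 7, [:: 281]); (7, 1, [:: 29; 43; 71; 113;
        211; 337]); (3, 1, [:: 73]); (1, 3, [:: 127; 181; 631])]);
      (544, [:: (2, 1, [:: 5]); (11, 11, [:: 23; 67; 1409]); (3, 3, [:: 7; 37]);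
        (3, 1, [:: 19; 397]); (1, 2, [:: 13]); (2, 1, [:: 89]); (1, 3,
        [:: 199]); (1, 2, [:: 73]); (5, 1, [:: 991; 1321]); (1, 5, [:: 11;
        31; 41; 331; 661]); (1, 3, [:: 271]); (3, 1, [:: 109; 433; 541]);
        (3, 3, [:: 163; 1621]); (1, 2, [:: 241]); (2, 1, [:: 881])]);
      (552, [:: (3, 1, [:: 7]); (5, 5, [:: 11; 61; 271]); (1, 3, [:: 31]); (1,
        3, [:: 73]); (3, 1, [:: 37]); (2, 1, [:: 181]); (7, 1, [:: 43;
        631]); (1, 7, [:: 71; 127; 211; 421]); (1, 2, [:: 13]); (2, 1,
        [:: 281]); (1, 2, [:: 17; 41]); (1, 2, [:: 193; 673]); (2, 1,
        [:: 113; 241; 337; 1009]); (3, 3, [:: 109; 379; 541; 757])]);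
      (576, [:: (3, 3, [:: 7]); (1, 3, [:: 19]); (3, 1, [:: 199]); (2, 1,
        [:: 13]); (1, 5, [:: 181]); (5, 1, [:: 11; 31; 61])]);
      (612, [:: (5, 5, [:: 11]); (3, 1, [:: 31]); (1, 6, [:: 7; 61]); (1, 3,
        [:: 19]); (3, 1, [:: 181; 541]); (2, 1, [:: 37]); (7, 1, [:: 211;
        701]); (1, 7, [:: 29; 43; 71; 127; 421; 631]); (1, 2, [:: 73]);
        (2, 1, [:: 41; 281]); (1, 2, [:: 241]); (2, 1, [:: 113; 337])]);
      (616, [:: (3, 2, [:: 13]); (1, 9, [:: 37]); (3, 1, [:: 19; 199]); (2, 1,
        [:: 109]); (7, 1, [:: 127]); (1, 7, [:: 29; 43; 379; 421]); (2, 1,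
        [:: 73]); (2, 2, [:: 113]); (1, 2, [:: 337; 1009]); (3, 1,
        [:: 433; 757]); (5, 1, [:: 71; 181]); (1, 5, [:: 31; 61; 211; 241;
        281; 631])]);
      (640, [:: (2, 3, [:: 13]); (5, 5, [:: 11; 31; 41]); (7, 7, [:: 43; 211]);
        (1, 2, [:: 29; 281]); (3, 1, [:: 7; 61; 421]); (3, 1, [:: 37;
        127]); (1, 3, [:: 19; 181; 631]); (2, 1, [:: 1009]); (1, 2,
        [:: 73]); (1, 2, [:: 17; 113]); (2, 1, [:: 241; 337]); (5, 1,
        [:: 701; 1051; 1801]); (1, 5, [:: 101; 151; 601; 1201]); (2, 2,
        [:: 97; 673])]);
      (652, [:: (3, 6, [:: 13]); (2, 1, [:: 37]); (1, 3, [:: 19]); (5, 1,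
        [:: 181]); (1, 5, [:: 11; 41; 61]); (2, 1, [:: 281]); (7, 1,
        [:: 43; 211]); (1, 7, [:: 29; 71; 127; 421]); (1, 2, [:: 113]);
        (1, 2, [:: 241]); (2, 1, [:: 17; 337]); (2, 1, [:: 97; 673]); (3,
        1, [:: 73]); (3, 1, [:: 541]); (1, 3, [:: 271; 379])]);
      (660, [:: (3, 3, [:: 7]); (2, 1, [:: 13]); (3, 2, [:: 37]); (2, 1,
        [:: 73]); (5, 1, [:: 61]); (1, 5, [:: 31; 41; 181; 1321]); (1, 3,
        [:: 19; 541]); (1, 7, [:: 281; 631]); (7, 1, [:: 29; 43; 71; 127;
        211; 421])]);
      (664, [:: (2, 1, [:: 5]); (3, 1, [:: 7]); (1, 15, [:: 31]); (5, 1,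
        [:: 11]); (1, 2, [:: 61]); (1, 2, [:: 241]); (1, 5, [:: 101; 151;
        601]); (2, 1, [:: 41]); (3, 1, [:: 19; 73]); (1, 3, [:: 37; 181]);
        (1, 3, [:: 109; 271])]);
      (684, [:: (2, 1, [:: 5]); (3, 3, [:: 7]); (5, 1, [:: 61]); (1, 5, [:: 11;
        31]); (1, 2, [:: 13]); (3, 1, [:: 181]); (2, 1, [:: 73]); (1, 2,
        [:: 41]); (1, 3, [:: 37; 1801]); (1, 2, [:: 241; 577]); (1, 2,
        [:: 97]); (1, 2, [:: 193; 769]); (3, 1, [:: 433]); (1, 3, [:: 109;
        271; 541])]);
      (700, [:: (3, 9, [:: 19]); (3, 1, [:: 37]); (2, 2, [:: 13]); (1, 2,
        [:: 73]); (5, 1, [:: 41; 61]); (1, 5, [:: 11; 31; 181]); (3, 1,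
        [:: 109; 1621]); (1, 3, [:: 271; 541]); (2, 2, [:: 241; 433]); (2,
        1, [:: 17; 1873]); (7, 1, [:: 421; 631; 1009]); (1, 7, [:: 29; 43;
        71; 113; 127; 337])]);
      (712, [:: (5, 5, [:: 11; 61])]);
      (720, [:: (3, 1, [:: 7]); (1, 2, [:: 13]); (5, 5, [:: 11; 41]); (1, 3,
        [:: 31; 61]); (1, 3, [:: 271]); (3, 1, [:: 19; 37; 181]); (7, 7,
        [:: 43; 71; 127; 211; 421; 631]); (2, 1, [:: 29; 281]); (2, 2,
        [:: 73])])].

Definition log_tables : dict table :=
  PositiveMap.mapi (fun l g => table_of (Pos.pred_N l) g) (dict_of primitive_roots).

Definition certified (tables : dict table) (c : N * seq (N * N * seq N)) : bool :=
  sieve tables (2 * c.1 - 1) c.1 2 2 [:: (1, 1)] c.2.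

Lemma log_tables_genuine : genuine log_tables.
Proof.
move=> l t; rewrite /lookup PositiveMap.gmapi N.pos_pred_succ.
by case: PositiveMap.find => //= g [<-]; exists g.
Qed.

Lemma all_certified : all (certified log_tables) certificates.
Proof. by vm_compute. Qed.

Lemma no_odd_solution k x y z :
    k \in [seq c.1 | c <- certificates] -> N.odd y -> N.odd z ->
  x ^ 2 + (2 * k - 1) ^ y <> k ^ z.
Proof.
case/mapP=> -[k' steps] /(allP all_certified) certified_k /= -> {k}.
move=> /N.odd_spec[i Ey] odd_z; have /N.odd_spec[j Ez] := odd_z.
move=> xyz; move: certified_k; apply/negP.
apply: (sieve_sound _ _ _ _ log_tables_genuine xyz odd_z).
by exists (1, 1), i, j; split=> //; [rewrite Ey | rewrite Ez]; apply: N.add_comm.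
Qed.

End Certificates.

Local Open Scope nat_scope.

(** * Parity of the exponents *)

Lemma N_of_expn m n : N.of_nat (m ^ n) = (N.of_nat m ^ N.of_nat n)%num.
Proof.
elim: n => // n IHn.
by rewrite expnS -multE Nnat.Nat2N.inj_mul IHn Nnat.Nat2N.inj_succ N.pow_succ_r'.
Qed.

Lemma N_odd_of_nat n : N.odd (N.of_nat n) = odd n.
Proof.
by elim: n => // n IHn; rewrite Nnat.Nat2N.inj_succ N.odd_succ -N.negb_odd IHn.
Qed.

Lemma certificates_cover :
  all (fun j => (4 %| j) ==> ((size (primes (2 * j - 1)) == 1) ==>
    (N.of_nat j \in [seq c.1 | c <- certificates]))) (iota 31 693).
Proof. by vm_compute. Qed.

(** A prime power has exactly one prime divisor. *)
Lemma certificates_complete k :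
    4 %| k -> 30 < k < 724 -> odd_prime_power (2 * k - 1) ->
  N.of_nat k \in [seq c.1 | c <- certificates].
Proof.
move=> k4 k_range [p [r [p_prime _ r_gt0 q_def]]].
have k_iota : k \in iota 31 693 by rewrite mem_iota.
move: (allP certificates_cover k k_iota) => /implyP/(_ k4)/implyP; apply.
by rewrite q_def primesX // primes_prime.
Qed.

(** As [2 * k - 1] is [- 1] modulo 4, an even [y] would make [- 1] a square
    modulo 4. *)
Lemma exponent_odd k x y z :
    4 %| k -> 0 < k -> 0 < z -> x ^ 2 + (2 * k - 1) ^ y = k ^ z -> odd y.
Proof.
move=> /dvdnP[j ->] k_gt0 z_gt0; apply: contra_eqT => even_y.
have q_mod : 2 * (j * 4) - 1 = 3 %[mod 4].
  case: j k_gt0 => // j _.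
  by rewrite (_ : 2 * (j.+1 * 4) - 1 = (2 * j + 1) * 4 + 3) ?modnMDl //; lia.
have qy_mod : (2 * (j * 4) - 1) ^ y = 1 %[mod 4].
  rewrite -modnXm q_mod modnXm -(odd_double_half y) (negbTE even_y) -mul2n expnM.
  by rewrite -modnXm exp1n.
apply/eqP => /(congr1 (modn^~ 4)).
have -> : (j * 4) ^ z %% 4 = 0 by rewrite -modnXm modnMl exp0n.
rewrite -modnDm qy_mod -modnXm.
by case: (x %% 4) (ltn_pmod x (isT : 0 < 4)) => [|[|[|[|]]]].
Qed.

(** The cofactor of [q + 1] in [q ^ n + 1], for odd [n], is an alternating sum of
    [n] powers of the odd number [q].  The induction uses
    [q ^ (n + 2) + 1 = q ^ 2 * (q ^ n + 1) - (q ^ 2 - 1)], where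
    [q ^ 2 - 1] is [q + 1] times an even number. *)
Lemma expn_odd_succ k a :
    0 < k -> exists2 t, odd t & (2 * k - 1) ^ a.*2.+1 + 1 = 2 * k * t.
Proof.
case: k => // k _; have -> : 2 * k.+1 - 1 = 2 * k + 1 by lia.
elim: a => [|a [t odd_t IHt]]; first by exists 1; lia.
have t_gt0 : 0 < t by case: t odd_t {IHt}.
have le_t : 2 * k <= (2 * k + 1) ^ 2 * t by nia.
exists ((2 * k + 1) ^ 2 * t - 2 * k).
  by rewrite oddB // oddM oddX oddD !oddM odd_t.
rewrite (_ : a.+1.*2.+1 = 2 + a.*2.+1) ?expnD ?doubleS //.
have sqE : (2 * k + 1) ^ 2 = 2 * k.+1 * (2 * k) + 1 by nia.
rewrite mulnBr mulnCA -IHt mulnDr muln1; move: (_ ^ 2) sqE => P -> {le_t}.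
by rewrite addnA addnAC addnK.
Qed.

(** The factors are powers of [p], and one of them is 1 because [p] does not
    divide both. *)
Lemma smaller_factor_1 p n a b :
    prime p -> a <= b -> ~~ (p %| a + b) -> a * b = p ^ n -> a = 1.
Proof.
move=> p_prime le_ab p_ndvd ab.
have /(dvdn_pfactor _ _ p_prime)[[|i] _ a_def] : a %| p ^ n.
- by rewrite -ab dvdn_mulr.
- by rewrite a_def.
have /(dvdn_pfactor _ _ p_prime)[[|j] _ b_def] : b %| p ^ n.
- by rewrite -ab dvdn_mull.
- by move: le_ab; rewrite a_def b_def leq_exp2l ?prime_gt1.
by case/negP: p_ndvd; rewrite a_def b_def dvdn_add ?dvdn_exp.
Qed.

Lemma even_exponent_solution k x y z :
    0 < k -> ~~ odd k -> odd_prime_power (2 * k - 1) ->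
    0 < z -> odd y -> ~~ odd z -> x ^ 2 + (2 * k - 1) ^ y = k ^ z ->
  [/\ x = k - 1, y = 1 & z = 2].
Proof.
move=> k_gt0 even_k [p [r [p_prime odd_p r_gt0 q_def]]] z_gt0 odd_y even_z.
have [m z_def] : exists m, z = m.+1.*2.
  exists z./2.-1; rewrite prednK; last by case: z even_z z_gt0 => [|[|]].
  by rewrite -[LHS]odd_double_half (negbTE even_z).
rewrite z_def -muln2 expnM; move w_pow: (k ^ m.+1) => w xyz.
have qy_gt0 : 0 < (2 * k - 1) ^ y by rewrite expn_gt0 q_def expn_gt0 prime_gt0.
have lt_xw : x < w by rewrite -ltn_sqr -xyz -[X in X < _]addn0 ltn_add2l.
have factor : (w - x) * (w + x) = p ^ (r * y).
  by rewrite -subn_sqr -xyz addKn q_def expnM.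
have sum_w : (w - x) + (w + x) = 2 * w.
  by rewrite addnCA (subnK (ltnW lt_xw)) addnn mul2n.
have p_ndvd_k : ~~ (p %| k).
  apply/negP => p_k.
  have : p %| 2 * k - (2 * k - 1) by rewrite dvdn_sub ?dvdn_mull // q_def dvdn_exp.
  by rewrite subKn ?muln_gt0 // Euclid_dvd1.
have p_ndvd_sum : ~~ (p %| (w - x) + (w + x)).
  rewrite sum_w Euclid_dvdM // negb_or -w_pow Euclid_dvdX // andbT p_ndvd_k andbT.
  by rewrite dvdn_prime2 //; apply: contraL odd_p => /eqP->.
have le_factors : w - x <= w + x := leq_trans (leq_subr _ _) (leq_addr _ _).
have wBx := smaller_factor_1 _ _ _ _ p_prime le_factors p_ndvd_sum factor.
have w_def : 2 * w = (2 * k - 1) ^ y + 1.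
  by rewrite q_def -expnM -factor -sum_w wBx mul1n addnC.
have [t odd_t qyE] := expn_odd_succ k y./2 k_gt0.
have y_def : y = y./2.*2.+1 by rewrite -[LHS]odd_double_half odd_y.
(* Dividing [2 * k ^ m.+1 = q ^ y + 1] by [2 * k] leaves an odd power of [k]. *)
have t_def : k ^ m = t.
  apply/eqP; rewrite -(eqn_pmul2l (_ : 0 < 2 * k)) ?muln_gt0 // -qyE -y_def -w_def.
  by rewrite -mulnA -expnS w_pow.
have m0 : m = 0.
  case: m {xyz lt_xw factor sum_w w_def wBx p_ndvd_sum le_factors z_def w_pow w}
    t_def => // m t_def.
  by move: odd_t; rewrite -t_def oddX (negbTE even_k).
rewrite -w_pow m0 expn1 in w_def wBx lt_xw.
have k_gt1 : 1 < k by case: (k) even_k k_gt0 => [|[|]].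
have q_gt1 : 1 < 2 * k - 1 by clear - k_gt1; lia.
split; [by rewrite -(subKn (ltnW lt_xw)) wBx | | by rewrite m0].
by apply: (expnI q_gt1); rewrite expn1 [in RHS]w_def addnK.
Qed.

Theorem theorem1p1 (R : realType) (hGRH : GRH R) (k : nat) (k_gt0 : 0 < k)
    (k_dvd4 : 4 %| k) (k_range : 30 < k < 724)
    (k_pp : odd_prime_power (2 * k - 1)) :
  forall x y z : nat, 0 < x -> 0 < y -> 0 < z ->
    (x ^ 2 + (2 * k - 1) ^ y = k ^ z
     <-> (x, y, z) = (k - 1, 1, 2)).
Proof.
move=> x y z _ _ z_gt0; split=> [xyz | [-> -> ->]]; last first.
  by rewrite expn1; have := mulnn k; rewrite -!mulnn; nia.
have odd_y := exponent_odd k x y z k_dvd4 k_gt0 z_gt0 xyz.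
have even_k : ~~ odd k by rewrite -dvdn2 (dvdn_trans _ k_dvd4).
case odd_z: (odd z).
  case: (no_odd_solution (N.of_nat k) (N.of_nat x) (N.of_nat y) (N.of_nat z)).
  - exact: certificates_complete.
  - by rewrite N_odd_of_nat.
  - by rewrite N_odd_of_nat odd_z.
  have := congr1 N.of_nat xyz; rewrite -plusE Nnat.Nat2N.inj_add !N_of_expn.
  by rewrite -minusE Nnat.Nat2N.inj_sub -multE Nnat.Nat2N.inj_mul.
have even_z := negbT odd_z.
by have [-> -> ->] :=
  even_exponent_solution k x y z k_gt0 even_k k_pp z_gt0 odd_y even_z xyz.
Qed.
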